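(* For every integer $n\geq 0$, \begin{align*} \overline{p}_{-11}(8n+1) &\equiv 0 \pmod{2}, & \overline{p}_{-11}(8n+2) &\equiv 0 \pmod{8}, & \overline{p}_{-11}(8n+3) &\equiv 0 \pmod{16}, \\ \overline{p}_{-11}(8n+4) &\equiv 0 \pmod{2}, & \overline{p}_{-11}(8n+7) &\equiv 0 \pmod{64}. \end{align*}
   Context: For $|q|<1$ let $(a;q)_\infty=\prod_{i\geq 0}(1-aq^i)$. For a positive integer $t$, the number $\overline{p}_{-t}(n)$ of $t$-colored overpartitions of $n$ is defined by the generating function \[ \sum_{n\geq 0}\overline{p}_{-t}(n)q^n=\frac{(q^2;q^2)_\infty^t}{(q;q)_\infty^{2t}}. \] *)

(* Defs.v *)
From HB Require Import structures.
From mathcomp Require Import all_boot all_order all_algebra.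
From mathcomp Require Import boolp.

Set Implicit Arguments.
Unset Strict Implicit.
Unset Printing Implicit Defensive.

Import Order.TTheory GRing.Theory Num.Theory.
Local Open Scope ring_scope.

(* Formal power series in one variable over R.  The wrapper keeps the Cauchy
   product apart from the pointwise product on functions [nat -> R]. *)
Record fps (R : Type) : Type := Fps { fps_coef : nat -> R }.

HB.instance Definition _ (R : Type) := [isNew for @fps_coef R].
HB.instance Definition _ (R : choiceType) := [Choice of fps R by <:].

Lemma fpsP (R : Type) (a b : fps R) :
  (forall n, fps_coef a n = fps_coef b n) -> a = b.
Proof. by case: a b => [a] [b] /= /funext ->. Qed.

Section FpsRing.
Variable R : comNzRingType.

Definition fps_add (a b : fps R) :=
  Fps (fun n => fps_coef a n + fps_coef b n).
Definition fps_opp (a : fps R) := Fps (fun n => - fps_coef a n).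
Definition fps_zero : fps R := Fps (fun=> 0).

Fact fps_addA : associative fps_add.
Proof. by move=> a b c; apply: fpsP => n /=; rewrite addrA. Qed.
Fact fps_addC : commutative fps_add.
Proof. by move=> a b; apply: fpsP => n /=; rewrite addrC. Qed.
Fact fps_add0 : left_id fps_zero fps_add.
Proof. by move=> a; apply: fpsP => n /=; rewrite add0r. Qed.
Fact fps_addN : left_inverse fps_zero fps_opp fps_add.
Proof. by move=> a; apply: fpsP => n /=; rewrite addNr. Qed.

HB.instance Definition _ := GRing.isZmodule.Build (fps R)
  fps_addA fps_addC fps_add0 fps_addN.

Definition fps_one : fps R := Fps (fun n => (n == 0)%:R).
Definition fps_mul (a b : fps R) :=
  Fps (fun n => \sum_(i < n.+1) fps_coef a i * fps_coef b (n - i)).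

Definition fps_trunc n (a : fps R) : {poly R} :=
  \poly_(i < n.+1) fps_coef a i.

Lemma coef_fps_trunc n a k : (k <= n)%N -> (fps_trunc n a)`_k = fps_coef a k.
Proof. by rewrite coef_poly ltnS => ->. Qed.

Lemma coef_fps_mul_trunc n a b k : (k <= n)%N ->
  fps_coef (fps_mul a b) k = (fps_trunc n a * fps_trunc n b)`_k.
Proof.
move=> le_kn; rewrite coefM; apply: eq_bigr => i _.
rewrite !coef_fps_trunc ?(leq_trans (leq_subr _ _)) //.
by apply: leq_trans le_kn; rewrite -ltnS.
Qed.

Fact fps_mulC : commutative fps_mul.
Proof.
by move=> a b; apply: fpsP => n; rewrite !(@coef_fps_mul_trunc n) // mulrC.
Qed.

Fact fps_mulA : associative fps_mul.
Proof.
move=> a b c; apply: fpsP => n.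
have -> : fps_coef (fps_mul a (fps_mul b c)) n
    = (fps_trunc n a * (fps_trunc n b * fps_trunc n c))`_n.
  rewrite coefM; apply: eq_bigr => i _.
  by rewrite (@coef_fps_mul_trunc n) ?leq_subr // coef_fps_trunc // -ltnS.
rewrite mulrA coefM; apply: eq_bigr => i _.
have le_in : (i <= n)%N by rewrite -ltnS.
by rewrite (coef_fps_mul_trunc _ _ le_in) coef_fps_trunc ?leq_subr.
Qed.

Fact fps_mul1 : left_id fps_one fps_mul.
Proof.
move=> a; apply: fpsP => n /=; rewrite big_ord_recl /= mul1r subn0.
by rewrite big1 ?addr0 // => i _; rewrite mul0r.
Qed.

Fact fps_mulDl : left_distributive fps_mul fps_add.
Proof.
move=> a b c; apply: fpsP => n /=; rewrite -big_split.
by apply: eq_bigr => i _; rewrite mulrDl.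
Qed.

Fact fps_one_neq0 : fps_one != 0.
Proof.
by apply/eqP => /(congr1 (fun a => fps_coef a 0))/eqP; rewrite oner_eq0.
Qed.

HB.instance Definition _ := GRing.Zmodule_isComNzRing.Build (fps R)
  fps_mulA fps_mulC fps_mul1 fps_mulDl fps_one_neq0.

Lemma fps_coef0 n : fps_coef (0 : fps R) n = 0. Proof. by []. Qed.
Lemma fps_coef1 n : fps_coef (1 : fps R) n = (n == 0)%:R. Proof. by []. Qed.
Lemma fps_coefN (a : fps R) n : fps_coef (- a) n = - fps_coef a n.
Proof. by []. Qed.
Lemma fps_coefD (a b : fps R) n :
  fps_coef (a + b) n = fps_coef a n + fps_coef b n.
Proof. by []. Qed.
Lemma fps_coefM (a b : fps R) n :
  fps_coef (a * b) n = \sum_(i < n.+1) fps_coef a i * fps_coef b (n - i).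
Proof. by []. Qed.

Definition fpsX : fps R := Fps (fun n => (n == 1)%:R).

Lemma fps_coefXn k n : fps_coef (fpsX ^+ k) n = (n == k)%:R.
Proof.
elim: k n => [|k IHk] n; first by rewrite expr0.
rewrite exprS fps_coefM; case: n => [|n].
  by rewrite big_ord_recl big_ord0 mul0r addr0.
rewrite !big_ord_recl mul0r add0r mul1r IHk /= subSS subn0 big1 ?addr0 //.
by move=> i _; rewrite mul0r.
Qed.

End FpsRing.

Section FpsUnit.
Variable R : comUnitRingType.

Definition fps_unit : {pred fps R} := [pred a | fps_coef a 0 \is a GRing.unit].

(* The first n coefficients b_0, ..., b_(n-1) of 1 / a, from
   b_0 = 1 / a_0 and b_m = - (a_m b_0 + ... + a_1 b_(m-1)) / a_0. *)
Fixpoint fps_inv_seq (a : fps R) (n : nat) : seq R :=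
  if n is m.+1 then
    let s := fps_inv_seq a m in
    rcons s ((fps_coef a 0)^-1 *
             ((m == 0)%:R - \sum_(j < m) fps_coef a (m - j) * s`_j))
  else [::].

Definition fps_inv (a : fps R) : fps R :=
  if a \in fps_unit then Fps (fun n => (fps_inv_seq a n.+1)`_n) else a.

Lemma size_fps_inv_seq a n : size (fps_inv_seq a n) = n.
Proof. by elim: n => //= n IHn; rewrite size_rcons IHn. Qed.

Lemma nth_fps_inv_seq a n k : (k < n)%N ->
  (fps_inv_seq a n)`_k = (fps_inv_seq a k.+1)`_k.
Proof.
elim: n => // n IHn; rewrite ltnS leq_eqVlt => /predU1P[-> // | lt_kn].
by rewrite -IHn // [in LHS]/= nth_rcons size_fps_inv_seq lt_kn.
Qed.

Fact fps_mulVr : {in fps_unit, left_inverse 1 fps_inv *%R}.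
Proof.
move=> a a_unit; apply: fpsP => n.
have a0_unit : fps_coef a 0 \is a GRing.unit := a_unit.
rewrite fps_coefM /fps_inv a_unit big_ord_recr subnn.
have -> : fps_coef (Fps (fun m => (fps_inv_seq a m.+1)`_m)) n =
    (fps_coef a 0)^-1 *
      ((n == 0)%:R - \sum_(j < n) fps_coef a (n - j) * (fps_inv_seq a n)`_j).
  by rewrite /= nth_rcons size_fps_inv_seq ltnn eqxx.
rewrite (mulrAC (fps_coef a 0)^-1) mulVr // mul1r fps_coef1.
set T := \sum_(j < n) fps_coef a _ * _.
transitivity (T + ((n == 0)%:R - T)); last by rewrite addrC subrK.
congr (_ + _); apply: eq_bigr => i _.
by rewrite mulrC (nth_fps_inv_seq a (ltn_ord i)).
Qed.

Fact fps_unitP (a b : fps R) : b * a = 1 -> a \in fps_unit.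
Proof.
move=> /(congr1 (fun c => fps_coef c 0)).
rewrite fps_coefM big_ord_recl big_ord0 addr0 /= => ba1.
rewrite subnn in ba1.
by apply/unitrP; exists (fps_coef b 0); split; rewrite // mulrC.
Qed.

Fact fps_inv_out : {in [predC fps_unit], fps_inv =1 id}.
Proof. by move=> a; rewrite inE /fps_inv => /negPf ->. Qed.

HB.instance Definition _ := GRing.ComNzRing_hasMulInverse.Build (fps R)
  fps_mulVr fps_unitP fps_inv_out.

Lemma fps_unitE (a : fps R) :
  (a \is a GRing.unit) = (fps_coef a 0 \is a GRing.unit).
Proof. by []. Qed.

End FpsUnit.

Section QPochhammer.
Variable R : comNzRingType.

Definition qpoch (a q : fps R) (N : nat) : fps R :=
  \prod_(i < N) (1 - a * q ^+ i).

(* (a; q)_oo, for q with zero constant term: by [qpoch_stable] below, the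
   n-th coefficient of (a; q)_N no longer depends on N once N > n, so the
   coefficientwise limit of the partial products can be read off at N = n + 1. *)
Definition qpoch_inf (a q : fps R) : fps R :=
  Fps (fun n => fps_coef (qpoch a q n.+1) n).

Lemma fps_coef_exp_lt (q : fps R) k n :
  fps_coef q 0 = 0 -> (n < k)%N -> fps_coef (q ^+ k) n = 0.
Proof.
move=> q0; elim: k n => // k IHk n lt_nk.
rewrite exprS fps_coefM big_ord_recl q0 mul0r add0r big1 // => i _.
rewrite IHk ?mulr0 //= /bump /= add1n.
case: n lt_nk i => [|n] lt_nk [i lt_i] //=.
by rewrite subSS (leq_ltn_trans (leq_subr _ _)).
Qed.

Lemma qpochS (a q : fps R) N :
  qpoch a q N.+1 = qpoch a q N * (1 - a * q ^+ N).
Proof. by rewrite /qpoch big_ord_recr. Qed.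

Lemma qpoch_stable (a q : fps R) n N : fps_coef q 0 = 0 -> (n < N)%N ->
  fps_coef (qpoch a q N) n = fps_coef (qpoch_inf a q) n.
Proof.
move=> q0; elim: N => // N IHN.
rewrite ltnS leq_eqVlt => /predU1P[-> // | lt_nN].
rewrite -IHN // qpochS mulrBr mulr1 fps_coefD fps_coefN.
rewrite mulrA fps_coefM big1 ?subr0 // => i _.
by rewrite fps_coef_exp_lt ?mulr0 // (leq_ltn_trans (leq_subr _ _)).
Qed.

End QPochhammer.

Local Notation q := (fpsX int).

Definition overpartition_gf (t : nat) : fps int :=
  qpoch_inf (q ^+ 2) (q ^+ 2) ^+ t / qpoch_inf q q ^+ (2 * t).

(* The number of t-coloured overpartitions of n. *)
Definition pbar (t n : nat) : int := fps_coef (overpartition_gf t) n.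

(* MathComp sets x^-1 = x off the units; the denominator above is a unit. *)
Lemma qpoch_inf_qq_unit : qpoch_inf q q \is a GRing.unit.
Proof.
rewrite fps_unitE /= /qpoch big_ord_recl big_ord0 mulr1 expr0 mulr1.
by rewrite fps_coefD fps_coefN subr0.
Qed.

Lemma overpartition_gfE t :
  overpartition_gf t * qpoch_inf q q ^+ (2 * t)
    = qpoch_inf (q ^+ 2) (q ^+ 2) ^+ t.
Proof. by rewrite divrK // unitrX // qpoch_inf_qq_unit. Qed.

(* Main.v *)
Require Import Defs.
From mathcomp Require Import all_boot all_order all_algebra.
From mathcomp Require Import ring zify.

(* Let phi(-q) = 1 + 2 theta with theta = \sum_(s >= 1) (-1)^s q^(s^2).  Gauss's
   identity phi(-q) (q^2; q^2)_oo = (q; q)_oo^2 says that the generating function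
   of the t-coloured overpartitions is phi(-q)^(-t).  Since (1 + 2 y)^(2^k) is 1
   modulo 2^(k+1), this is congruent to phi(-q)^s modulo 2^(k+1) as soon as 2^k
   divides t + s: for t = 11 one takes s = 0, 1, 5, 21 modulo 2, 8, 16, 64.  It
   remains to expand (1 + 2 theta)^s and to look at sums of squares modulo 8:
   squares are 1 (odd) or 0, 4 (even).  For instance 8n + 7 is not a sum of at
   most three squares, and four or five squares with that sum include exactly
   three odd ones, which gives the factors 'C(4, 3) = 4 and 'C(5, 3) = 10. *)

Set Implicit Arguments.
Unset Strict Implicit.
Unset Printing Implicit Defensive.

Import GRing.Theory.
Local Open Scope ring_scope.

(** * Shanks's finite identity *)

Section Shanks.
Variables (R : comUnitRingType) (x : R).
Hypothesis add_unit : forall i, 1 + x ^+ i.+1 \is a GRing.unit.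
Hypothesis sub_unit : forall i, 1 - x ^+ i.+1 \is a GRing.unit.

Definition shanks_prod n := \prod_(i < n) ((1 - x ^+ i.+1) / (1 + x ^+ i.+1)).

(* Shanks's finite form of Gauss's identity (shanks_identity below):
   \sum_(|s| <= n) (-1)^s x^(s^2)
     = P_n + \sum_(1 <= s <= n) 2 (-1)^s x^(s (n + 1)) P_n / (P_s (1 + x^s)),
   where P_n = shanks_prod n; the last sum is O(x^(n + 1)). *)
Definition shanks_term n s :=
  (-1) ^+ s * 2%:R * x ^+ (s * n.+1) * (shanks_prod n / shanks_prod s)
  / (1 + x ^+ s).

Lemma shanks_prod0 : shanks_prod 0 = 1.
Proof. exact: big_ord0. Qed.

Lemma shanks_prodS n :
  shanks_prod n.+1 = shanks_prod n * ((1 - x ^+ n.+1) / (1 + x ^+ n.+1)).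
Proof. by rewrite /shanks_prod big_ord_recr. Qed.

Lemma shanks_prod_unit n : shanks_prod n \is a GRing.unit.
Proof.
elim: n => [|n IHn]; first by rewrite shanks_prod0 unitr1.
by rewrite shanks_prodS !unitrM IHn sub_unit unitrV add_unit.
Qed.

(** Induction on [m]: each new difference turns the right side for [m] into the one for [m.+1]. At
    [m = n] both products cancel, leaving a multiple of [x ^+ (n.+1 ^ 2)] that becomes the next term
    of the theta sum. *)
Lemma shanks_telescope n m :
  shanks_prod n.+1 - shanks_prod n
    + \sum_(s < m) (shanks_term n.+1 s.+1 - shanks_term n s.+1)
  = (-1) ^+ m.+1 * 2%:R * x ^+ (m.+1 * n.+1) * (shanks_prod n / shanks_prod m)
    / (1 + x ^+ n.+1).
Proof.
have Eb := mulVr (add_unit n).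
elim: m => [|m IHm].
  rewrite big_ord0 addr0 shanks_prodS shanks_prod0 divr1 mul1n.
  move: Eb; set b := x ^+ n.+1; set eb := (1 + b)^-1 => Eb.
  have split_b y : y = y * eb + y * (b * eb).
    by transitivity (y * (eb * (1 + b))); [rewrite Eb mulr1 | ring].
  by rewrite [X in _ - X]split_b; ring.
have Ea := mulVr (add_unit m).
rewrite big_ord_recr /= addrA IHm /shanks_term shanks_prodS.
have -> : (shanks_prod m)^-1
    = (shanks_prod m.+1)^-1 * ((1 - x ^+ m.+1) / (1 + x ^+ m.+1)).
  rewrite shanks_prodS invrM ?shanks_prod_unit ?unitrM ?sub_unit ?unitrV ?add_unit //.
  by rewrite mulrAC mulVr ?mul1r // unitrM sub_unit unitrV add_unit.
have -> : x ^+ (m.+1 * n.+2) = x ^+ (m.+1 * n.+1) * x ^+ m.+1.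
  by rewrite -exprD [(m.+1 * n.+2)%N]mulnS addnC.
have -> : x ^+ (m.+2 * n.+1) = x ^+ (m.+1 * n.+1) * x ^+ n.+1.
  by rewrite -exprD [(m.+2 * n.+1)%N]mulSn addnC.
rewrite !(exprS (-1)).
move: ((shanks_prod m.+1)^-1) (shanks_prod n) ((-1) ^+ m) (x ^+ (m.+1 * n.+1)).
move: Ea Eb; set a := x ^+ m.+1; set b := x ^+ n.+1.
set ea := (1 + a)^-1; set eb := (1 + b)^-1 => Ea Eb Q p sg c.
apply/eqP; rewrite -subr_eq0; apply/eqP.
(* [ring] sees [ea] and [eb] as atoms, so the difference of the sides is written as a combination of
   [ea * (1 + a) - 1] and [eb * (1 + b) - 1], which vanish. *)
transitivity (2 * sg * c * p * Q *
    (b * eb * (ea * (1 + a) - 1) - ea * (eb * (1 + b) - 1))); first by ring.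
by rewrite Ea Eb !subrr !mulr0 subrr mulr0.
Qed.

Lemma shanks_identity n :
  1 + 2%:R * \sum_(s < n) (-1) ^+ s.+1 * x ^+ (s.+1 ^ 2)
  = shanks_prod n + \sum_(s < n) shanks_term n s.+1.
Proof.
elim: n => [|n IHn]; first by rewrite !big_ord0 shanks_prod0 mulr0.
rewrite big_ord_recr /= mulrDr addrA IHn big_ord_recr /=.
have := shanks_telescope n n; rewrite sumrB divrr ?shanks_prod_unit // mulr1.
rewrite /(shanks_term n.+1 n.+1) divrr ?shanks_prod_unit // mulr1.
have -> : x ^+ (n.+1 * n.+2) = x ^+ (n.+1 ^ 2) * x ^+ n.+1.
  by rewrite -exprD [(n.+1 * n.+2)%N]mulnS mulnn addnC.
rewrite mulnn; have Eb := mulVr (add_unit n).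
move: Eb; set b := x ^+ n.+1; set eb := (1 + b)^-1 => Eb.
have split_b y : y = y * eb + y * (b * eb).
  by transitivity (y * (eb * (1 + b))); [rewrite Eb mulr1 | ring].
set S1 := \sum_(i < n) shanks_term n.+1 _; set S0 := \sum_(i < n) _.
move: (shanks_prod n.+1) (shanks_prod n) S1 S0 => p1 p0 S1 S0 E.
transitivity (p1 - p0 + (S1 - S0) + (p0 + S0)
   + (-1) ^+ n.+1 * 2 * x ^+ (n.+1 ^ 2) * b * eb); last by ring.
by rewrite E [X in _ + 2 * X = _]split_b; ring.
Qed.
End Shanks.

(** * Congruence modulo a power of the variable, and supports in residue classes *)

Section FpsCoefficients.
Variable R : comNzRingType.
Implicit Types a b c : fps R.

Definition fps_eqm N a b := forall k, (k < N)%N -> fps_coef a k = fps_coef b k.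

Lemma fps_eqm_sym N a b : fps_eqm N a b -> fps_eqm N b a.
Proof. by move=> ab k lt_kN; rewrite ab. Qed.

Lemma fps_eqm_trans N a b c : fps_eqm N a b -> fps_eqm N b c -> fps_eqm N a c.
Proof. by move=> ab bc k lt_kN; rewrite ab // bc. Qed.

Lemma fps_eqmM N a b c (d : fps R) :
  fps_eqm N a b -> fps_eqm N c d -> fps_eqm N (a * c) (b * d).
Proof.
move=> ab cd k lt_kN; rewrite !fps_coefM; apply: eq_bigr => -[i /= lt_ik] _.
by rewrite ab ?cd // (leq_ltn_trans _ lt_kN) // leq_subr.
Qed.

Lemma fps_coef_sum (I : Type) (r : seq I) (P : pred I) (F : I -> fps R) n :
  fps_coef (\sum_(i <- r | P i) F i) n = \sum_(i <- r | P i) fps_coef (F i) n.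
Proof. by apply: (big_morph (fun a => fps_coef a n)). Qed.

Lemma fps_coefMn a k n : fps_coef (a *+ k) n = fps_coef a n *+ k.
Proof. by elim: k => // k IHk; rewrite !mulrS fps_coefD IHk. Qed.

Lemma fps_coefDMn a b k n :
  fps_coef (a + b *+ k) n = fps_coef a n + fps_coef b n *+ k.
Proof. by rewrite fps_coefD fps_coefMn. Qed.

Lemma fps_coefXnM a k n : (n < k)%N -> fps_coef (fpsX R ^+ k * a) n = 0.
Proof.
move=> lt_nk; rewrite fps_coefM big1 // => -[i /= lt_in] _.
by rewrite fps_coefXn (_ : i == k = false) ?mul0r //; lia.
Qed.

Definition fps_supp (d r : nat) a := forall n, n <> r %[mod d] -> fps_coef a n = 0.

Lemma fps_suppM d r s a b :
  fps_supp d r a -> fps_supp d s b -> fps_supp d (r + s) (a * b).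
Proof.
move=> ar bs n ne_n; rewrite fps_coefM big1 // => -[i /= lt_in] _.
have [Ei|/eqP /ar->] := eqVneq (i %% d)%N (r %% d)%N; last by rewrite mul0r.
rewrite bs ?mulr0 // => Es; apply: ne_n.
by rewrite -(subnKC (m := i) (n := n)) // -modnDm Ei Es modnDm.
Qed.

Lemma fps_supp1 d : fps_supp d 0 1.
Proof. by case=> // n; rewrite fps_coef1. Qed.

Lemma fps_suppX d r a k : fps_supp d r a -> fps_supp d (k * r) (a ^+ k).
Proof.
move=> ar; elim: k => [|k IHk]; first by rewrite expr0; apply: fps_supp1.
by rewrite exprS mulSn; apply: fps_suppM.
Qed.

Lemma fps_supp_dvd d e r a :
  (e %| d)%N -> fps_supp d r a -> fps_supp e r a.
Proof.
move=> e_d ar n ne_n; apply: ar => Enr; apply: ne_n.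
by rewrite -(modn_dvdm n e_d) Enr modn_dvdm.
Qed.

End FpsCoefficients.

(** * The theta series and Gauss's identity *)

(** A root [s.+1] of [n] is at most [n], so the finite range [s < n] misses no square. *)
Definition theta : fps int :=
  Fps (fun n => \sum_(s < n) (-1) ^+ s.+1 * (n == (s.+1 ^ 2)%N)%:R).

Local Notation q := (fpsX int).

Lemma theta_coef n N : (n <= N)%N ->
  fps_coef theta n = fps_coef (\sum_(s < N) (-1) ^+ s.+1 * q ^+ (s.+1 ^ 2)) n.
Proof.
move=> le_nN; rewrite fps_coef_sum.
transitivity (\sum_(s < N) (-1) ^+ s.+1 * (n == (s.+1 ^ 2)%N)%:R : int); last first.
  apply: eq_bigr => s _; rewrite -fps_coefXn -[in LHS]signr_odd -[in RHS]signr_odd.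
  by case: (odd _); rewrite ?expr0 ?mul1r ?expr1 ?mulN1r ?fps_coefN.
rewrite /= (big_ord_widen _ (fun s => (-1) ^+ s.+1 * (n == (s.+1 ^ 2)%N)%:R) le_nN).
rewrite big_mkcond; apply: eq_bigr => s _; case: ltnP => // le_ns.
by rewrite (_ : (n == _) = false) ?mulr0 //; nia.
Qed.

Lemma gauss_theta :
  (1 + 2%:R * theta) * qpoch_inf (q ^+ 2) (q ^+ 2) = qpoch_inf q q ^+ 2.
Proof.
have q0 : fps_coef q 0 = 0 by [].
have q20 : fps_coef (q ^+ 2) 0 = 0 by rewrite fps_coefXn.
have add_unit i : 1 + q ^+ i.+1 \is a GRing.unit.
  by rewrite fps_unitE fps_coefD fps_coefXn addr0 unitr1.
have sub_unit i : 1 - q ^+ i.+1 \is a GRing.unit.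
  by rewrite fps_unitE fps_coefD fps_coefN fps_coefXn subr0 unitr1.
apply: fpsP => n; pose N := n.+1.
suff: fps_eqm N ((1 + 2%:R * theta) * qpoch_inf (q ^+ 2) (q ^+ 2))
                (qpoch_inf q q ^+ 2) by apply.
have stable (a b : fps int) (b0 : fps_coef b 0 = 0) :
    fps_eqm N (qpoch_inf a b) (qpoch a b N).
  by move=> k lt_kN; rewrite qpoch_stable.
have theta_prod : fps_eqm N (1 + 2%:R * theta) (shanks_prod q N).
  move=> k lt_kN; transitivity
    (fps_coef (1 + 2%:R * \sum_(s < N) (-1) ^+ s.+1 * q ^+ (s.+1 ^ 2)) k).
    by rewrite !fps_coefD !mulr_natl !fps_coefMn (@theta_coef k N) // ltnW.
  (* Each correction term carries a power of [q] with exponent at least [N.+1], so it is invisible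
     below [N]. *)
  rewrite shanks_identity // fps_coefD fps_coef_sum big1 ?addr0 // => s _.
  have : (k < s.+1 * N.+1)%N by nia.
  rewrite /shanks_term; move: (s.+1 * N.+1)%N => e lt_ke.
  by rewrite [_ * q ^+ e]mulrC -!mulrA fps_coefXnM.
apply: fps_eqm_trans (fps_eqmM theta_prod (stable _ _ q20)) _.
(* Factor by factor, with b a power of [q]: (1 - b) / (1 + b) times 1 - b^2 is (1 - b)^2. *)
have -> : shanks_prod q N * qpoch (q ^+ 2) (q ^+ 2) N = qpoch q q N * qpoch q q N.
  rewrite /shanks_prod /qpoch -!big_split; apply: eq_bigr => i _ /=.
  have Ei : q ^+ 2 * (q ^+ 2) ^+ i = q ^+ i.+1 * q ^+ i.+1.
    by rewrite -exprS -exprM mulnC exprM expr2.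
  rewrite Ei -exprS; have := mulVr (add_unit i).
  move: (q ^+ i.+1) => b; set e := (1 + b)^-1 => Eb.
  transitivity ((1 - b) * (1 - b) * (e * (1 + b))); first by ring.
  by rewrite Eb mulr1.
by rewrite expr2; apply: fps_eqmM; apply: fps_eqm_sym; apply: stable.
Qed.

Lemma overpartition_gf_theta t :
  overpartition_gf t * (1 + 2%:R * theta) ^+ t = 1.
Proof.
have unit1 := unitrX (2 * t) qpoch_inf_qq_unit.
apply: (mulIr unit1); rewrite mul1r mulrAC overpartition_gfE -exprMn.
by rewrite [X in X ^+ t]mulrC gauss_theta exprM.
Qed.

(** * Reduction modulo powers of 2 *)

Lemma expr_1D2_pow2 (R : comNzRingType) (y : R) k :
  exists w, (1 + 2%:R * y) ^+ (2 ^ k) = 1 + w *+ 2 ^ k.+1.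
Proof.
elim: k => [|k [w IHk]]; first by exists y; rewrite expr1 mulr_natl.
exists (w + w ^+ 2 *+ 2 ^ k); rewrite expnSr exprM IHk.
by rewrite !expnS; move: (2 ^ k)%N => M; ring.
Qed.

Lemma expr_1D2 (R : comNzRingType) (y : R) k m :
  exists w, (1 + 2%:R * y) ^+ (2 ^ k * m) = 1 + w *+ 2 ^ k.+1.
Proof.
have [w Ew] := expr_1D2_pow2 y k.
elim: m => [|m [v Ev]]; first by exists 0; rewrite muln0 mul0rn addr0.
exists (w + v + w * v *+ 2 ^ k.+1).
by rewrite mulnS exprD Ew Ev; move: (2 ^ k.+1)%N => M; ring.
Qed.

Lemma dvdz_mulrn (z : int) d : (d %| z *+ d)%Z.
Proof. by rewrite -mulr_natr natz dvdz_mull. Qed.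

(** The generating function is phi(-q)^(-t); multiplying it by phi(-q)^(t + s), which is 1 modulo
    2^(k+1), gives phi(-q)^s. *)
Lemma pbar_dvd t k m s n : (t + s = 2 ^ k * m)%N ->
  ((2 ^ k.+1)%N %| fps_coef ((1 + 2%:R * theta) ^+ s) n)%Z ->
  (pbar t n = 0 %[mod (2 ^ k.+1)%N])%Z.
Proof.
move=> Ets; have [w Ew] := expr_1D2 theta k m.
have Egf : (1 + 2%:R * theta) ^+ s
    = overpartition_gf t + (overpartition_gf t * w) *+ 2 ^ k.+1.
  transitivity (overpartition_gf t * (1 + w *+ 2 ^ k.+1)).
    by rewrite -Ew -Ets exprD mulrA overpartition_gf_theta mul1r.
  by rewrite mulrDr mulr1 mulrnAr.
rewrite Egf fps_coefD fps_coefMn rpredDr ?dvdz_mulrn // => dvd_pbar.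
by apply/eqP; rewrite eqz_mod_dvd subr0.
Qed.

(** * Odd and even squares, and coefficients of powers of theta *)

Definition theta_odd : fps int :=
  Fps (fun n => if odd n then fps_coef theta n else 0).
Definition theta_even : fps int :=
  Fps (fun n => if odd n then 0 else fps_coef theta n).

Lemma theta_split : theta = theta_odd + theta_even.
Proof.
by apply: fpsP => n; rewrite fps_coefD /=; case: odd; rewrite ?addr0 ?add0r.
Qed.

Lemma theta_coef_nsquare n :
  (forall s, n <> (s ^ 2)%N) -> fps_coef theta n = 0.
Proof.
move=> nsq; rewrite /= big1 // => s _; case: eqP => [/nsq //|_].
by rewrite mulr0.
Qed.

(** With s = 2m + 1, s^2 = 8k + 1 where k = m(m + 1)/2 is triangular. *)
Lemma theta_odd_supp : fps_supp 8 1 theta_odd.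
Proof.
move=> n ne_n /=; case: ifP => // odd_n; apply: theta_coef_nsquare => s Es.
apply: ne_n; move: odd_n; rewrite {}Es oddX /= => odd_s.
set m := s./2; pose k := (m * m.+1)./2.
have Ek : (k.*2 = m * m.+1)%N by rewrite even_halfK // oddM /= andbN.
have -> : (s ^ 2 = k * 8 + 1)%N.
  by rewrite -(odd_double_half s) odd_s -/m; nia.
by rewrite modnMDl.
Qed.

Lemma theta_even_supp : fps_supp 4 0 theta_even.
Proof.
move=> n ne_n /=; case: ifP => // even_n; apply: theta_coef_nsquare => s Es.
apply: ne_n; move: even_n; rewrite {}Es oddX /= => even_s.
by rewrite -(odd_double_half s) even_s -muln2 expnMn modnMl.
Qed.

Lemma supp_theta_monomial i j : fps_supp 4 i (theta_odd ^+ i * theta_even ^+ j).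
Proof.
have odd4 : fps_supp 4 1 theta_odd by apply: fps_supp_dvd theta_odd_supp.
have := fps_suppM (fps_suppX (k := i) odd4) (fps_suppX (k := j) theta_even_supp).
by rewrite muln1 muln0 addn0.
Qed.

Lemma theta2_coef n : (n %% 4 = 3)%N -> fps_coef (theta ^+ 2) n = 0.
Proof.
move=> En; have -> : theta ^+ 2 = theta_odd ^+ 0 * theta_even ^+ 2
    + (theta_odd ^+ 1 * theta_even ^+ 1) *+ 2 + theta_odd ^+ 2 * theta_even ^+ 0.
  by rewrite theta_split; ring.
by rewrite 2!fps_coefD fps_coefMn !supp_theta_monomial ?En.
Qed.

(** Modulo 4 only three odd squares could contribute, but their sum is 3 modulo 8. *)
Lemma theta3_coef n : (n %% 8 = 7)%N -> fps_coef (theta ^+ 3) n = 0.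
Proof.
move=> En; have En4 : (n %% 4 = 3)%N by lia.
have -> : theta ^+ 3 = theta_odd ^+ 0 * theta_even ^+ 3
    + (theta_odd ^+ 1 * theta_even ^+ 2) *+ 3
    + (theta_odd ^+ 2 * theta_even ^+ 1) *+ 3 + theta_odd ^+ 3.
  by rewrite theta_split; ring.
rewrite 3!fps_coefD !fps_coefMn !supp_theta_monomial ?En4 //.
by rewrite (fps_suppX (k := 3) theta_odd_supp) ?En.
Qed.

Lemma theta4_coef n : (n %% 4 = 3)%N ->
  exists z, fps_coef (theta ^+ 4) n = z *+ 4.
Proof.
move=> En; exists (fps_coef (theta_odd ^+ 3 * theta_even ^+ 1) n).
have -> : theta ^+ 4 = theta_odd ^+ 0 * theta_even ^+ 4
    + (theta_odd ^+ 1 * theta_even ^+ 3) *+ 4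
    + (theta_odd ^+ 2 * theta_even ^+ 2) *+ 6
    + (theta_odd ^+ 3 * theta_even ^+ 1) *+ 4 + theta_odd ^+ 4 * theta_even ^+ 0.
  by rewrite theta_split; ring.
rewrite 4!fps_coefD !fps_coefMn (@supp_theta_monomial 0) ?En //.
rewrite (@supp_theta_monomial 1) ?En // (@supp_theta_monomial 2) ?En //.
by rewrite (@supp_theta_monomial 4) ?En // !mul0rn !add0r addr0.
Qed.

Lemma theta5_coef n : (n %% 4 = 3)%N ->
  exists z, fps_coef (theta ^+ 5) n = z *+ 2.
Proof.
move=> En; exists (fps_coef (theta_odd ^+ 3 * theta_even ^+ 2) n *+ 5).
have -> : theta ^+ 5 = theta_odd ^+ 0 * theta_even ^+ 5
    + (theta_odd ^+ 1 * theta_even ^+ 4) *+ 5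
    + (theta_odd ^+ 2 * theta_even ^+ 3) *+ 10
    + (theta_odd ^+ 3 * theta_even ^+ 2) *+ 10
    + (theta_odd ^+ 4 * theta_even ^+ 1) *+ 5 + theta_odd ^+ 5 * theta_even ^+ 0.
  by rewrite theta_split; ring.
rewrite 5!fps_coefD !fps_coefMn (@supp_theta_monomial 0) ?En //.
rewrite (@supp_theta_monomial 1) ?En // (@supp_theta_monomial 2) ?En //.
rewrite (@supp_theta_monomial 4) ?En // (@supp_theta_monomial 5) ?En //.
by rewrite !mul0rn !add0r !addr0 -mulrnA.
Qed.

Lemma theta_coef_23 n : (n %% 4 = 2)%N \/ (n %% 4 = 3)%N -> fps_coef theta n = 0.
Proof.
move=> En.
have -> : theta = theta_odd ^+ 0 * theta_even ^+ 1 + theta_odd ^+ 1 * theta_even ^+ 0.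
  by rewrite theta_split; ring.
by rewrite !fps_coefD !supp_theta_monomial //; lia.
Qed.

(** The coefficients are 'C(21, j) 2^j reduced modulo 64; they vanish from j = 6 on. The exponent is
    split as 16 + 5. *)
Lemma expr_1D2_21 (R : comNzRingType) (y : R) : exists w,
  (1 + 2%:R * y) ^+ 21
  = 1 + y *+ 42 + y ^+ 2 *+ 8 + y ^+ 3 *+ 16 + y ^+ 4 *+ 16 + y ^+ 5 *+ 32
    + w *+ 64.
Proof.
have [w Ew] : exists w, (1 + 2%:R * y) ^+ 16 = 1 + (y + y ^+ 2) *+ 32 + w *+ 64.
  (* Chosen so that (1 + 2y)^4 = 1 + 8z; the witness collects the multiples of 64 in (1 + 8z)^4. *)
  pose z := y + y ^+ 2 + (y + y ^+ 2) ^+ 2 *+ 2.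
  exists ((y + y ^+ 2) ^+ 2 + z ^+ 2 *+ 2 + (z + z ^+ 2 *+ 4) ^+ 2 *+ 4).
  have E4 : (1 + 2%:R * y) ^+ 4 = 1 + z *+ 8 by rewrite /z; ring.
  have -> : (1 + 2%:R * y) ^+ 16 = ((1 + 2%:R * y) ^+ 4) ^+ 4 by rewrite -exprM.
  have Ez : y + y ^+ 2 = z - (y + y ^+ 2) ^+ 2 *+ 2 by rewrite addrK.
  rewrite E4 {1}Ez; ring.
rewrite (exprD _ 16 5) Ew.
exists (y ^+ 2 + y ^+ 3 + y ^+ 4
  + (y + y ^+ 2) * (y *+ 5 + y ^+ 2 *+ 20 + y ^+ 3 *+ 40 + y ^+ 4 *+ 40 + y ^+ 5 *+ 16)
  + w * (1 + 2%:R * y) ^+ 5).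
ring.
Qed.

Theorem theorem1p3 : forall n : nat,
  [/\ (pbar 11 (8 * n + 1) = 0 %[mod 2])%Z,
      (pbar 11 (8 * n + 2) = 0 %[mod 8])%Z,
      (pbar 11 (8 * n + 3) = 0 %[mod 16])%Z,
      (pbar 11 (8 * n + 4) = 0 %[mod 2])%Z
    & (pbar 11 (8 * n + 7) = 0 %[mod 64])%Z].
Proof.
move=> n; split.
- apply: (@pbar_dvd 11 0 11 0); rewrite // expr0 fps_coef1.
  by rewrite (_ : (_ == _) = false) //; lia.
- apply: (@pbar_dvd 11 2 3 1); rewrite // expr1 fps_coefD fps_coef1 mulr_natl.
  rewrite fps_coefMn theta_coef_23 ?mul0rn ?addr0; last by lia.
  by rewrite (_ : (_ == _) = false) //; lia.
- apply: (@pbar_dvd 11 3 2 5); rewrite //.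
  (* The coefficients 80, 80 and 32 are multiples of 16; the lower terms vanish at exponents 3
     modulo 4. *)
  have -> : (1 + 2%:R * theta) ^+ 5 = 1 + theta *+ 10 + theta ^+ 2 *+ 40
      + (theta ^+ 3 *+ 5 + theta ^+ 4 *+ 5 + theta ^+ 5 *+ 2) *+ 16 by ring.
  have En : ((8 * n + 3) %% 4 = 3)%N by lia.
  rewrite 3!fps_coefDMn.
  rewrite theta2_coef // theta_coef_23; last by right.
  rewrite fps_coef1 (_ : (_ == _) = false); last by lia.
  by rewrite !mul0rn !add0r dvdz_mulrn.
- apply: (@pbar_dvd 11 0 11 0); rewrite // expr0 fps_coef1.
  by rewrite (_ : (_ == _) = false) //; lia.
- apply: (@pbar_dvd 11 5 1 21); rewrite //.
  have [w ->] := expr_1D2_21 theta.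
  have En8 : ((8 * n + 7) %% 8 = 7)%N by lia.
  have En : ((8 * n + 7) %% 4 = 3)%N by lia.
  have [z4 E4] := theta4_coef En; have [z5 E5] := theta5_coef En.
  rewrite 6!fps_coefDMn E4 E5 theta2_coef // theta3_coef //.
  rewrite theta_coef_23; last by right.
  rewrite fps_coef1 (_ : (_ == _) = false); last by lia.
  (* The surviving factors are 4 * 16, 2 * 32 and 64. *)
  rewrite !mul0rn !add0r -!mulrnA -!mulrnDl; exact: dvdz_mulrn.
Qed.
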